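(* Let $X$ be a Banach space with a Schauder basis $\{e_i\}_{i\ge1}$. Fix a sequence $\epsilon=\{\epsilon_i\}$ of positive reals decreasing to $0$. Assume there is a continuous map $\phi:bb_D(X)\rightarrow bb_D(X)$ such that for every $x=\{x_i\}\in bb(X)$ the sequence $\phi(x)$ is a subsequence of $x$ which $\epsilon$-generates a spreading model. Then $X$ contains almost isometric copies of $c_0$, or contains almost isometric copies of $\ell_p$ for some $1\leq p<\infty$.
   Context: Scalars are real. $bb(X)$ is the set of (infinite) normalized block bases of $\{e_i\}$, i.e. sequences of norm-one finite linear combinations of the $e_i$ with successive supports. $bb_D(X)$ is $bb(X)$ with the topology induced by the product topology on $X^{\mathbb N}$, where $X$ is given the discrete topology. Two (finite or infinite) basic sequences satisfy $(x_i)\sim^{C}(y_i)$ ($C$-equivalence) if $C^{-1}\|\sum a_i x_i\|\le\|\sum a_i y_i\|\le C\|\sum a_i x_i\|$ for all finitely supported scalars $(a_i)$. A seminormalized basic sequence $\{x_i\}$ (i.e. $0<c<\|x_i\|<C$ for some $c,C$ and all $i$) generates a spreading model $\{\tilde x_i\}$ if for all $k$ and all scalars $r_1,\dots,r_k$ the limit $\lim_{l_1<\cdots<l_k,\ l_1\to\infty}\|r_1x_{l_1}+\cdots+r_kx_{l_k}\|$ exists, in which case $\|r_1\tilde x_1+\cdots+r_k\tilde x_k\|$ is defined to be this limit. A basic sequence $\{x_i\}$ $\epsilon$-generates a spreading model $\{\tilde x_i\}$ if it generates $\{\tilde x_i\}$ as its spreading model and for any $k<n_1<n_2<\cdots<n_k$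 one has $(x_{n_1},\ldots,x_{n_k})\sim^{1+\epsilon_k}(\tilde x_1,\ldots,\tilde x_k)$. $X$ contains almost isometric copies of $c_0$ (resp. $\ell_p$) if for every $\delta>0$, $X$ has a subspace $(1+\delta)$-isomorphic to $c_0$ (resp. $\ell_p$). *)

(* Defs.v *)
From HB Require Import structures.
From mathcomp Require Import all_boot all_order all_algebra.
From mathcomp Require Import all_classical all_reals all_analysis.

Set Implicit Arguments.
Unset Strict Implicit.
Unset Printing Implicit Defensive.

Import Order.TTheory GRing.Theory Num.Theory.
Import numFieldNormedType.Exports.

Local Open Scope classical_set_scope.
Local Open Scope ring_scope.

(* All sequences are indexed from 0: [e i], [x i], [eps i] stand for the terms
   of index i + 1 in the usual numbering from 1. *)

Definition schauder_basis_of (R : realType) (X : normedModType R) (Y : set X)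
    (e : nat -> X) : Prop :=
  (forall i, Y (e i)) /\
  (forall x, Y x ->
     exists! a : nat -> R, series (fun i => a i *: e i) @ \oo --> x).

Definition schauder_basis (R : realType) (X : normedModType R) (e : nat -> X) :
    Prop :=
  schauder_basis_of [set: X] e.

Definition closed_span (R : realType) (X : normedModType R) (e : nat -> X) :
    set X :=
  closure [set x | exists (n : nat) (a : nat -> R),
                     x = \sum_(i < n) a i *: e i].

Definition basic_sequence (R : realType) (X : normedModType R) (x : nat -> X) :
    Prop :=
  schauder_basis_of (closed_span x) x.

Definition seminormalized (R : realType) (X : normedModType R) (x : nat -> X) :
    Prop :=
  exists c C : R, 0 < c /\ forall i, c < `|x i| < C.

(* The supports of the [x i] are nonempty since [`|x i| = 1], so it is enough
   to compare consecutive ones. *)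
Definition normalized_block_basis (R : realType) (X : normedModType R)
    (e x : nat -> X) : Prop :=
  exists c : nat -> nat -> R,
    [/\ forall i, finite_set [set j | c i j != 0],
        forall i, x i = \sum_(j \in [set j | c i j != 0]) c i j *: e j,
        forall i, `|x i| = 1
      & forall i j k, c i j != 0 -> c i.+1 k != 0 -> (j < k)%N].

Definition discrete_seq (X : choiceType) : Type :=
  prod_topology (fun _ : nat => discrete_topology X).

Definition bb (R : realType) (X : normedModType R) (e : nat -> X) :
    set (discrete_seq X) :=
  [set x | normalized_block_basis e x].

Definition subsequence (T : Type) (y x : nat -> T) : Prop :=
  exists2 s : nat -> nat, {homo s : i j / (i < j)%N} & y = x \o s.

Definition fin_equivalent (R : realType) (X Z : normedModType R) (C : R)
    (k : nat) (x : 'I_k -> X) (z : 'I_k -> Z) : Prop :=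
  forall a : 'I_k -> R,
    C^-1 * `|\sum_(i < k) a i *: x i| <= `|\sum_(i < k) a i *: z i|
      <= C * `|\sum_(i < k) a i *: x i|.

Definition generates_spreading_model (R : realType) (X Z : normedModType R)
    (x : nat -> X) (z : nat -> Z) : Prop :=
  [/\ basic_sequence x,
      seminormalized x
    & forall (k : nat) (r : 'I_k -> R) (eta : R), 0 < eta ->
        exists N : nat, forall l : 'I_k -> nat,
          {homo l : i j / (i < j)%N} -> (forall i, (N <= l i)%N) ->
          `| `|\sum_(i < k) r i *: x (l i)| - `|\sum_(i < k) r i *: z i| |
            < eta].

(* The second clause is the condition for k + 1 vectors: in the numbering from
   1 the first chosen index is [n ord0 + 1], and k + 1 < n ord0 + 1 reads
   [k < n ord0]. *)
Definition eps_generates (R : realType) (X Z : normedModType R)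
    (eps : nat -> R) (x : nat -> X) (z : nat -> Z) : Prop :=
  generates_spreading_model x z /\
  forall (k : nat) (n : 'I_k.+1 -> nat),
    {homo n : i j / (i < j)%N} -> (k < n ord0)%N ->
    fin_equivalent (1 + eps k) (fun i => x (n i)) (fun i : 'I_k.+1 => z i).

Definition closed_subspace (R : realType) (X : normedModType R) (Y : set X) :
    Prop :=
  [/\ closed Y, Y 0 & forall (s : R) (x y : X), Y x -> Y y -> Y (s *: x + y)].

(* A sequence space is given by its carrier [E] and the norm [N] on it; [A] and
   [B] are bounds for the norms of the isomorphism [T] and of its inverse. *)
Definition contains_isomorph (R : realType) (X : normedModType R)
    (E : set (nat -> R)) (N : (nat -> R) -> R) (K : R) : Prop :=
  exists (Y : set X) (T : (nat -> R) -> X) (A B : R),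
    [/\ closed_subspace Y,
        set_bij E Y T,
        forall (s : R) (a b : nat -> R), E a -> E b ->
          T (fun i => s * a i + b i) = s *: T a + T b,
        forall a, E a -> `|T a| <= A * N a /\ N a <= B * `|T a|
      & A * B <= K].

Definition contains_almost_isometric_copies (R : realType)
    (X : normedModType R) (E : set (nat -> R)) (N : (nat -> R) -> R) : Prop :=
  forall delta : R, 0 < delta -> contains_isomorph X E N (1 + delta).

Definition c0_space (R : realType) : set (nat -> R) :=
  [set a | a @ \oo --> (0 : R)].

Definition c0_norm (R : realType) (a : nat -> R) : R :=
  sup (range (fun i => `|a i|)).

Definition lp_space (R : realType) (p : R) : set (nat -> R) :=
  [set a | ('N[counting]_(p%:E)[EFin \o a] < +oo)%E].

Definition lp_norm (R : realType) (p : R) (a : nat -> R) : R :=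
  fine ('N[counting]_(p%:E)[EFin \o a])%E.

(* Main.v *)
Require Import Defs.
From HB Require Import structures.
From mathcomp Require Import all_boot all_order all_algebra.
From mathcomp Require Import all_classical all_reals all_analysis.
From mathcomp Require Import lra.
Import Order.TTheory GRing.Theory Num.Theory.
Import numFieldNormedType.Exports.
Local Open Scope classical_set_scope.
Local Open Scope ring_scope.

Set Implicit Arguments.
Unset Strict Implicit.
Unset Printing Implicit Defensive.

(* Only pairs of vectors of the spreading models are needed. By continuity, the
   first terms of [phi x] are fixed by finitely many terms of [x], after which
   the rest of [x] may be replaced by any block sequence. Continuing [x] by
   [phi w] shows that all the [phi x] have the same two-dimensional spreading
   model [N a b]. Continuing it by vectors on which an estimate fails shows that
   for every [C > 1], every unit vector [v] supported far enough satisfies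
   |a v + b z| ~ N a b up to the factor [C] for all unit vectors [z] supported
   far beyond [v]. Computing the norm of [a u + b v + c w] in two ways, [N] is
   associative, whence [N] is the max norm or an l_p norm (Bohnenblust). The
   same estimate, applied to successive vectors [v i] with constants whose
   product is close to 1, makes [v] almost isometrically equivalent to the unit
   basis of c_0 or l_p. *)

(** * Continuity in a product of discrete spaces *)

Lemma discrete_continuity_modulus (X : choiceType) (B : set (discrete_seq X))
    (phi : discrete_seq X -> discrete_seq X) (x : discrete_seq X) (k : nat) :
  {within B, continuous phi} -> B x ->
  exists L : nat, forall x', B x' -> (forall j, (j < L)%N -> x' j = x j) ->
    forall j, (j < k)%N -> phi x' j = phi x j.
Proof.
move=> /subspace_continuousP phi_cont Bx; apply: contrapT => /forallNP noL.
(* Counterexamples [xs L] for every [L] converge to [x], so [phi (xs L)] tends to [phi x]; in a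
   discrete factor this means eventual equality, and finitely many coordinates can be treated at
   once. *)
have /choice[xs xsP] (L : nat) : exists x',
    [/\ B x', forall j, (j < L)%N -> x' j = x j &
      exists2 j, (j < k)%N & phi x' j <> phi x j].
  have /existsNP[x' /not_implyP[Bx' /not_implyP[xx' /existsNP[j]]]] := noL L.
  by move=> /not_implyP[jk phij]; exists x'; split=> //; exists j.
have xs_x : xs @ \oo --> x.
  apply/cvg_sup => i; apply/cvg_image.
    by apply/seteqP; split=> // y _; exists (fun=> y).
  move=> A /nbhs_singleton Axi; exists [set y : discrete_seq X | A (y i)].
    by exists i.+1 => // n /= ni; have [_ /(_ i ni) ->] := xsP n.
  by apply/seteqP; split=> [_ [y /= ? <-]|y Ay] //; exists (fun=> y).
have xs_within : xs @ \oo --> within B (nbhs x).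
  by move=> A /xs_x[M _ MA]; exists M => // n /MA; apply; have [] := xsP n.
have phi_xs : phi \o xs @ \oo --> phi x by apply: cvg_comp xs_within (phi_cont _ Bx).
have phi_xs_j j : \forall n \near \oo, phi (xs n) j = phi x j.
  have proj_j := @proj_continuous nat (fun=> discrete_topology X) j (phi x).
  exact: (cvg_comp _ _ phi_xs proj_j [set phi x j] (discrete_set1 _)).
have [n _ nP] : \forall n \near \oo, forall j : 'I_k, phi (xs n) j = phi x j.
  apply: filter_forall => j; exact: phi_xs_j.
have [_ _ [j jk]] := xsP n; apply; exact: (nP n (leqnn n) (Ordinal jk)).
Qed.

Lemma archimedean_le0 (R : realType) (x C : R) :
  (forall k : nat, k%:R * x <= C) -> x <= 0.
Proof.
move=> kx; rewrite leNgt; apply/negP => x0.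
have := kx (Num.trunc (C / x)).+1; apply/negP; rewrite -ltNge.
rewrite -ltr_pdivrMr //; exact: truncnS_gt.
Qed.

(** * Bohnenblust's theorem for associative homogeneous functions *)

Section Bohnenblust.
Context {R : realType} (N : R -> R -> R).
Hypothesis N_homo : forall t a b : R, 0 <= t -> N (t * a) (t * b) = t * N a b.
Hypothesis N10 : N 1 0 = 1.
Hypothesis N01 : N 0 1 = 1.
Hypothesis N11 : N 1 1 <= 2.
Hypothesis N_mono : forall a b a' b' : R,
  0 <= a <= a' -> 0 <= b <= b' -> N a b <= N a' b'.
Hypothesis N_assoc : forall a b c : R, 0 < a -> 0 < b -> 0 < c ->
  N (N a b) c = N a (N b c).

Let Na0 (a : R) : 0 <= a -> N a 0 = a.
Proof.
move=> a0; rewrite -[X in N X]mulr1 -[X in N _ X](mulr0 a).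
by rewrite N_homo // N10 mulr1.
Qed.

Let N0b (b : R) : 0 <= b -> N 0 b = b.
Proof.
move=> b0; rewrite -[X in N _ X]mulr1 -[X in N X](mulr0 b).
by rewrite N_homo // N01 mulr1.
Qed.

Let N_ge_l (a b : R) : 0 <= a -> 0 <= b -> a <= N a b.
Proof. move=> a0 b0; rewrite -{1}(Na0 a0); apply: N_mono; by rewrite ?lexx ?a0 ?b0. Qed.

Let N_ge_r (a b : R) : 0 <= a -> 0 <= b -> b <= N a b.
Proof. move=> a0 b0; rewrite -{1}(N0b b0); apply: N_mono; by rewrite ?lexx ?a0 ?b0. Qed.

Let N_ge0 (a b : R) : 0 <= a -> 0 <= b -> 0 <= N a b.
Proof. by move=> a0 b0; apply: le_trans a0 (N_ge_l a0 b0). Qed.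

Let N_assoc0 (a b c : R) : 0 <= a -> 0 <= b -> 0 <= c ->
  N (N a b) c = N a (N b c).
Proof.
move=> a_ge0 b_ge0 c_ge0.
have [<-|a0] := predU1P (etrans (esym (le_eqVlt 0 a)) a_ge0).
  by rewrite !N0b ?N_ge0.
have [<-|b0] := predU1P (etrans (esym (le_eqVlt 0 b)) b_ge0).
  by rewrite N0b // Na0.
have [<-|c0] := predU1P (etrans (esym (le_eqVlt 0 c)) c_ge0).
  by rewrite !Na0 ?N_ge0.
exact: N_assoc.
Qed.

(* The value of [N] iterated over [n] ones; it turns out to be n^(1/p). *)
Fixpoint cumulative (n : nat) : R :=
  if n is m.+1 then N (cumulative m) 1 else 0.
Local Notation lam := cumulative.

Let lam_ge0 n : 0 <= lam n.
Proof. by elim: n => //= n ih; rewrite N_ge0. Qed.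

Let lamD n m : lam (n + m) = N (lam n) (lam m).
Proof.
elim: m => [|m ih]; first by rewrite addn0 Na0.
by rewrite addnS /= ih N_assoc0.
Qed.

(** Associativity gives [lamD]; homogeneity then turns the combination of [m] copies of [lam n] into
    a product. *)
Let lamM n m : lam (n * m) = lam n * lam m.
Proof.
elim: m => [|m ih]; first by rewrite muln0 mulr0.
by rewrite mulnS addnC lamD ih /= -{2}(mulr1 (lam n)) N_homo.
Qed.

Let lamX n k : lam (n ^ k) = lam n ^+ k.
Proof.
elim: k => [|k ih]; first by rewrite expn0 expr0 /= N01.
by rewrite expnS exprS lamM ih.
Qed.

Let lam_homo : {homo lam : n m / (n <= m)%N >-> n <= m}.
Proof.
by apply: homo_leq => [//|m n p|n]; [exact: le_trans|exact: N_ge_l].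
Qed.

Let lam_ge1 n : (0 < n)%N -> 1 <= lam n.
Proof. by move=> n0; have := @lam_homo 1 n n0; rewrite /= N01. Qed.

Let lam2 : lam 2 = N 1 1. Proof. by rewrite /= N01. Qed.

(** A monotone multiplicative function on the positive integers is a power: compare [m ^ k] with
    powers of 2 and let [k] grow. *)
Let lam_powR : 1 < N 1 1 ->
  exists2 p : R, 1 <= p & forall n, lam n `^ p = n%:R.
Proof.
move=> N11_gt1.
have l2_gt0 : 0 < ln 2 :> R by rewrite ln_gt0 ?ltr1n.
have L2_gt0 : 0 < ln (N 1 1) by rewrite ln_gt0.
have N11_gt0 : 0 < N 1 1 by lra.
(* The only exponent possible at [n = 2]; it is at least 1 because [N 1 1 <= 2]. *)
exists (ln 2 / ln (N 1 1)).
  by rewrite ler_pdivlMr // mul1r ler_ln ?posrE.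
set p := _ / _.
have p0 : 0 < p by rewrite divr_gt0.
case=> [|n]; first by rewrite powR0 ?gt_eqF.
set m := n.+1; have m0 : 0 < m%:R :> R by rewrite ltr0n.
have lm0 : 0 < lam m by rewrite (lt_le_trans _ (@lam_ge1 m _)).
(* With [2 ^ j <= m ^ k < 2 ^ j.+1], both [k * ln m] and [k * p * ln (lam m)] lie between [j * ln 2]
   and [j.+1 * ln 2]. The bound is independent of [k], so the difference of the logarithms
   vanishes. *)
have log_bound k : `|k%:R * (p * ln (lam m) - ln m%:R)| <= ln 2.
  have mk0 : (0 < m ^ k)%N by rewrite expn_gt0.
  pose j := trunc_log 2 (m ^ k).
  have /andP[jm mj] : (2 ^ j <= m ^ k < 2 ^ j.+1)%N.
    by rewrite trunc_logP //= trunc_log_ltn.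
  have lam_j i : ln (lam (2 ^ i)) = i%:R * ln (N 1 1).
    by rewrite lamX lam2 lnXn // mulr_natl.
  have lam_m : ln (lam (m ^ k)) = k%:R * ln (lam m).
    by rewrite lamX lnXn // mulr_natl.
  have nat_j i : ln ((2 ^ i)%:R : R) = i%:R * ln 2.
    by rewrite natrX lnXn ?mulr_natl.
  have nat_m : ln ((m ^ k)%:R : R) = k%:R * ln m%:R.
    by rewrite natrX lnXn ?mulr_natl.
  have pL2 : p * ln (N 1 1) = ln 2 by rewrite /p divfK ?gt_eqF.
  have h1 : j%:R * ln 2 <= k%:R * ln (m%:R : R).
    by rewrite -nat_j -nat_m ler_ln ?posrE ?ltr0n ?expn_gt0 // ler_nat.
  have h2 : k%:R * ln (m%:R : R) <= j.+1%:R * ln 2.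
    by rewrite -nat_j -nat_m ler_ln ?posrE ?ltr0n ?expn_gt0 // ler_nat ltnW.
  have lam_pos i : (0 < i)%N -> 0 < lam i.
    by move=> i0; rewrite (lt_le_trans _ (lam_ge1 i0)).
  have h3 : j%:R * ln 2 <= p * (k%:R * ln (lam m)).
    rewrite -pL2 (mulrCA _ p) -lam_j -lam_m ler_pM2l // ler_ln ?posrE ?lam_pos ?expn_gt0 //.
    exact: lam_homo.
  have h4 : p * (k%:R * ln (lam m)) <= j.+1%:R * ln 2.
    rewrite -pL2 (mulrCA _ p) -lam_j -lam_m ler_pM2l // ler_ln ?posrE ?lam_pos ?expn_gt0 //.
    exact/lam_homo/ltnW.
  rewrite mulrBr mulrCA ler_norml; move: h1 h2 h3 h4; rewrite -natr1; lra.
apply: ln_inj; rewrite ?posrE ?powR_gt0 // ln_powR.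
apply/eqP; rewrite -subr_eq0 -normr_le0; apply/archimedean_le0 => k.
have := log_bound k; rewrite normrM ger0_norm //; exact.
Qed.

Lemma bohnenblust :
  (forall a b : R, 0 <= a -> 0 <= b -> N a b = Num.max a b) \/
  exists2 p : R, 1 <= p &
    forall a b : R, 0 <= a -> 0 <= b -> N a b `^ p = a `^ p + b `^ p.
Proof.
have [N11_gt1|N11_le1] := ltP 1 (N 1 1).
  right; have [p p1 lamp] := lam_powR N11_gt1; exists p => // a b a0 b0.
  have p0 : 0 < p by lra.
  have pV0 : 0 <= p^-1 by rewrite invr_ge0 ltW.
  have lamE n : lam n = n%:R `^ p^-1.
    by rewrite -lamp -powRrM mulfV ?gt_eqF // powRr1.
  have powK (x : R) : 0 <= x -> (x `^ p) `^ p^-1 = x.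
    by move=> x0; rewrite -powRrM mulfV ?gt_eqF // powRr1.
  have powVK (x : R) : 0 <= x -> (x `^ p^-1) `^ p = x.
    by move=> x0; rewrite -powRrM mulVf ?gt_eqF // powRr1.
  (* After scaling by [q^(1/p)], the two arguments lie between consecutive values of [lam], at [m],
     [m.+1] and at [n], [n.+1]. By [lamD] the p-th power of [N] then lies between [m + n] and
     [m + n + 2], whatever [q] is. *)
  have bound (q : nat) : `|q%:R * (N a b `^ p - (a `^ p + b `^ p))| <= 2.
    pose m := Num.trunc (q%:R * a `^ p); pose n := Num.trunc (q%:R * b `^ p).
    have q0 : 0 <= q%:R :> R by [].
    have qa0 : 0 <= q%:R * a `^ p by rewrite mulr_ge0 ?powR_ge0.
    have qb0 : 0 <= q%:R * b `^ p by rewrite mulr_ge0 ?powR_ge0.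
    have /andP[ma am] : m%:R <= q%:R * a `^ p < m.+1%:R by exact: trunc_itv.
    have /andP[nb bn] : n%:R <= q%:R * b `^ p < n.+1%:R by exact: trunc_itv.
    have scaled x : 0 <= x -> q%:R `^ p^-1 * x = (q%:R * x `^ p) `^ p^-1.
      by move=> x0; rewrite powRM ?powR_ge0 // powK.
    have NE : q%:R * N a b `^ p = (N (q%:R `^ p^-1 * a) (q%:R `^ p^-1 * b)) `^ p.
      by rewrite N_homo ?powR_ge0 // powRM ?powR_ge0 ?N_ge0 // powVK.
    have pow_le (r x y : R) : 0 <= r -> 0 <= x -> x <= y -> x `^ r <= y `^ r.
      by move=> r0 x0 xy; apply: ge0_ler_powR; rewrite ?nnegrE // (le_trans x0).
    have Nq0 : 0 <= N (q%:R `^ p^-1 * a) (q%:R `^ p^-1 * b).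
      by rewrite N_ge0 ?mulr_ge0 ?powR_ge0.
    have h1 : (m + n)%:R <= q%:R * N a b `^ p.
      rewrite NE -(lamp (_ + _)%N); apply: (pow_le _ _ _ (ltW p0) (lam_ge0 _)); rewrite lamD; apply: N_mono;
        rewrite lam_ge0 lamE scaled //=; exact: pow_le.
    have h2 : q%:R * N a b `^ p <= (m.+1 + n.+1)%:R.
      rewrite NE -(lamp (_ + _)%N); apply: (pow_le _ _ _ (ltW p0) Nq0); rewrite lamD; apply: N_mono;
        rewrite mulr_ge0 ?powR_ge0 // lamE scaled //=; exact/pow_le/ltW.
    move: h1 h2 am bn; rewrite ler_norml !natrD -!natr1; lra.
  apply/eqP; rewrite -subr_eq0 -normr_le0; apply/archimedean_le0 => k.
  have := bound k; rewrite normrM ger0_norm //; exact.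
left=> a b a0 b0; apply/eqP; rewrite eq_le ge_max N_ge_l // N_ge_r // !andbT.
have max0 : 0 <= Num.max a b by rewrite le_max a0.
(* If [N 1 1 <= 1], monotonicity and homogeneity bound [N a b] by the maximum times [N 1 1]. *)
apply: (@le_trans _ _ (N (Num.max a b) (Num.max a b))).
  by apply: N_mono; rewrite ?a0 ?b0 le_max lexx ?orbT.
by rewrite -{1 2}(mulr1 (Num.max a b)) N_homo // ler_piMr.
Qed.

End Bohnenblust.

(** * Comparison of reals up to a factor *)

Section Comparison.
Context {R : realType}.
Implicit Types C D u v w : R.

(** Two products instead of a quotient: symmetric in [u] and [v], and usable at 0. *)
Definition within_factor C u v := u <= C * v /\ v <= C * u.

Lemma within_factor_sym C u v : within_factor C u v -> within_factor C v u.
Proof. by case. Qed.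

Lemma within_factor_trans D C u v w : 0 <= C -> 0 <= D ->
  within_factor C u v -> within_factor D v w -> within_factor (C * D) u w.
Proof.
move=> C0 D0 [uv vu] [vw wv]; split.
  by rewrite -mulrA (le_trans uv) // ler_wpM2l.
by rewrite [C * D]mulrC -mulrA (le_trans wv) // ler_wpM2l.
Qed.

Lemma within_factor_le C D u v : 0 <= u -> 0 <= v -> C <= D ->
  within_factor C u v -> within_factor D u v.
Proof.
move=> u0 v0 CD [uv vu].
by split; [apply: (le_trans uv)|apply: (le_trans vu)]; rewrite ler_wpM2r.
Qed.

Lemma within_factor_refl C u : 1 <= C -> 0 <= u -> within_factor C u u.
Proof. by move=> C1 u0; split; rewrite ler_peMl. Qed.

Lemma le_all_factors u v : 0 <= v -> (forall C, 1 < C -> u <= C * v) -> u <= v.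
Proof.
move=> v0 uCv; apply/ler_addgt0Pr => d d0.
have v1 : 0 < v + 1 by lra.
have dv : 0 < d / (v + 1) by rewrite divr_gt0.
apply: (le_trans (uCv (1 + d / (v + 1)) _)); first by lra.
by rewrite mulrDl mul1r lerD2l mulrAC ler_pdivrMr // ler_pM2l //; lra.
Qed.

Lemma exp_root_gt1 (n : nat) C : 1 < C -> exists2 D, 1 < D & D ^+ n.+1 = C.
Proof.
move=> C1; have C0 : 0 <= C by lra.
exists (C `^ n.+1%:R^-1); last first.
  by rewrite -powR_mulrn ?powR_ge0 // -powRrM mulVf ?pnatr_eq0 // powRr1.
by rewrite /powR gt_eqF ?expR_gt1 ?mulr_gt0 ?ln_gt0 ?invr_gt0 ?ltr0n//; lra.
Qed.

(** Serves for chains of [n.+1] comparisons, each up to [C]: the powers [C ^+ n.+1] take every value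
    above 1. *)
Lemma within_all_factors_eq (n : nat) u v : 0 <= u -> 0 <= v ->
  (forall C, 1 < C -> within_factor (C ^+ n.+1) u v) -> u = v.
Proof.
move=> u0 v0 uv; apply/eqP; rewrite eq_le; apply/andP; split.
  by apply: le_all_factors => // C /(exp_root_gt1 n)[D D1 <-]; case: (uv D D1).
by apply: le_all_factors => // C /(exp_root_gt1 n)[D D1 <-]; case: (uv D D1).
Qed.

End Comparison.

(** * Block sequences with explicit cut points *)

Section Blocks.
Context {R : realType} {X : normedModType R} (e : nat -> X).
Implicit Types (p : nat -> nat) (x : nat -> X) (v w : X).

Definition spanned_between (m n : nat) v :=
  exists2 c : nat -> R, (forall j, c j != 0 -> (m <= j < n)%N) &
    v = \sum_(j < n) c j *: e j.
Local Notation seg := spanned_between.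

Lemma spanned_between_widen m n m' n' v : (m' <= m)%N -> (n <= n')%N ->
  seg m n v -> seg m' n' v.
Proof.
move=> mm nn [c cP ->]; exists c => [j /cP /andP[mj jn]|].
  by rewrite (leq_trans mm mj) (leq_trans jn nn).
rewrite (big_ord_widen _ (fun j => c j *: e j) nn) [LHS]big_mkcond /=.
apply: eq_bigr => j _; case: ltnP => // nj.
have [->|/cP] := eqVneq (c j) 0; first by rewrite scale0r.
by rewrite ltnNge nj andbF.
Qed.

Lemma spanned_betweenZ m n s v : seg m n v -> seg m n (s *: v).
Proof.
move=> [c cP ->]; exists (fun j => s * c j).
  by move=> j; rewrite mulf_eq0 => /norP[_ /cP].
by rewrite scaler_sumr; apply: eq_bigr => j _; rewrite scalerA.
Qed.

Lemma spanned_betweenD m n v w : seg m n v -> seg m n w -> seg m n (v + w).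
Proof.
move=> [c cP ->] [d dP ->]; exists (fun j => c j + d j) => [j|].
  have [->|/cP //] := eqVneq (c j) 0; rewrite add0r; exact: dP.
by rewrite -big_split; apply: eq_bigr => j _; rewrite scalerDl.
Qed.

Lemma spanned_between0 m n : seg m n 0.
Proof.
exists (fun=> 0) => [j|]; first by rewrite eqxx.
by rewrite big1 // => j _; rewrite scale0r.
Qed.

Lemma spanned_between_lt m n v : v != 0 -> seg m n v -> (m < n)%N.
Proof.
move=> v0 [c cP vE]; rewrite ltnNge; apply: contra_neqN v0 => nm.
rewrite vE big1 // => j _; have [->|/cP/andP[mj jn]] := eqVneq (c j) 0.
  by rewrite scale0r.
by have := leq_trans nm mj; rewrite leqNgt jn.
Qed.

Definition block_sequence p x := forall i,
  [/\ (p i <= p i.+1)%N, seg (p i) (p i.+1) (x i) & `|x i| = 1].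

Lemma block_sequence_bb p x : block_sequence p x -> bb e x.
Proof.
move=> px.
have /choice[c cP] i : exists c : nat -> R,
    (forall j, c j != 0 -> (p i <= j < p i.+1)%N) /\
    x i = \sum_(j < p i.+1) c j *: e j.
  by have [_ [c ? ?] _] := px i; exists c.
have supp i : [set j | c i j != 0] `<=` `I_(p i.+1).
  by move=> j /(proj1 (cP i)) /andP[].
exists c; split=> [i|i|i|i j k].
- exact: sub_finite_set (supp i) (finite_II _).
- have [_ ->] := cP i; rewrite (@fsbig_ord _ _ _ _ (fun j => c i j *: e j)).
  apply/esym/fsbig_widen => // j [_ /= /negP]; rewrite negbK => /eqP ->.
  by rewrite scale0r.
- by have [] := px i.
- move=> /(proj1 (cP i)) /andP[_ jp] /(proj1 (cP i.+1)) /andP[pk _].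
  exact: leq_trans jp pk.
Qed.

Lemma bb_block_sequence x : bb e x -> exists p, block_sequence p x.
Proof.
move=> [c [cfin xE x1 csucc]].
have /choice[m mP] i : exists m, c i m != 0 /\ forall j, c i j != 0 -> (j <= m)%N.
  have c_ex : exists j, c i j != 0.
    apply: contrapT => /forallNP c0; have := x1 i; rewrite xE.
    rewrite (_ : [set j | c i j != 0] = set0); last first.
      by apply/seteqP; split=> // j /(c0 j).
    by rewrite fsbig_set0 normr0 => /eqP; rewrite eq_sym oner_eq0.
  have [F cF] := (finite_seqP _).1 (cfin i).
  have c_bound j : c i j != 0 -> (j <= \max_(k <- F) k)%N.
    move=> cj; apply: (@leq_bigmax_seq _ _ xpredT id) => //.
    by have : [set j | c i j != 0] j by []; rewrite cF.
  by have [m cm mmax] := ex_maxnP c_ex c_bound; exists m.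
(* Each cut is placed just after the last index in the support of the preceding vector. *)
pose p i := if i is i'.+1 then (m i').+1 else 0%N.
have cp i j : c i j != 0 -> (p i <= j < p i.+1)%N.
  move=> cij; have [_ /(_ j cij) /= jm] := mP i; rewrite ltnS jm andbT.
  case: i cij jm => // i cij jm /=.
  exact: csucc (proj1 (mP i)) cij.
exists p => i; have [cm _] := mP i; have /andP[pm mp] := cp _ _ cm; split=> //.
- by rewrite (leq_trans pm) // ltnW.
- exists (c i); first exact: cp.
  rewrite xE (@fsbig_ord _ _ _ _ (fun j => c i j *: e j)).
  apply: fsbig_widen => [j /cp /andP[]//|j [_ /= /negP]].
  by rewrite negbK => /eqP ->; rewrite scale0r.
Qed.

Lemma block_sequence_ge p x : block_sequence p x -> forall i, (i <= p i)%N.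
Proof.
move=> px; elim=> // i ih; apply: leq_ltn_trans ih _.
have [_ xi x1] := px i; apply: spanned_between_lt xi.
by rewrite -normr_gt0 x1.
Qed.

Lemma block_sequence_tail p x (m : nat) : block_sequence p x ->
  block_sequence (fun i => p (m + i)%N) (fun i => x (m + i)%N).
Proof. by move=> px i; rewrite addnS; exact: px. Qed.

Lemma block_sequence_splice p x p' (w : nat -> X) (L : nat) : block_sequence p x ->
  block_sequence p' w -> (p L <= p' 0)%N ->
  bb e (fun i => if (i < L)%N then x i else w (i - L)%N).
Proof.
move=> px p'w pp'.
(* At [i = L] the interval runs from [p L] to [p' 1], so it absorbs the gap before [w 0]. *)
apply: (@block_sequence_bb (fun i => if (i <= L)%N then p i else p' (i - L)%N)).
move=> i; have [iL|Li|->] := ltngtP i L.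
- exact: px.
- rewrite subSn 1?(ltnW Li) //; exact: p'w.
- have [p'1 w0 w1] := p'w 0%N; rewrite subnn subSnn; split=> //.
    exact: leq_trans pp' p'1.
  exact: spanned_between_widen w0.
Qed.

(** The cut [n] may lie well beyond the support of [v], so [Q] can force the next vector to start
    far out. *)
Lemma block_recursion (Q : nat -> nat -> X -> Prop) (M0 : nat) :
  (forall i M, exists n v, [/\ (M <= n)%N, seg M n v & Q i n v]) ->
  exists p x, p 0%N = M0 /\ forall i,
    [/\ (p i <= p i.+1)%N, seg (p i) (p i.+1) (x i) & Q i (p i.+1) (x i)].
Proof.
move=> QP.
have /choice[f fP] (iM : nat * nat) : exists nv : nat * X,
    [/\ (iM.2 <= nv.1)%N, seg iM.2 nv.1 nv.2 & Q iM.1 nv.1 nv.2].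
  by have [n [v nv]] := QP iM.1 iM.2; exists (n, v).
pose p := fix p i := if i is i'.+1 then (f (i', p i')).1 else M0.
by exists p, (fun i => (f (i, p i)).2); split=> // i; exact: (fP (i, p i)).
Qed.

End Blocks.

(** * Consequences of a continuous choice of subsequences *)

Section ContinuousChoice.
Context {R : realType} {X : completeNormedModType R} (e : nat -> X).
Variables (eps : nat -> R) (phi : discrete_seq X -> discrete_seq X).
Hypothesis he : schauder_basis e.
Hypothesis eps_gt0 : forall i, 0 < eps i.
Hypothesis eps_cvg0 : eps @ \oo --> (0 : R).
Hypothesis phi_bb : forall x, bb e x -> bb e (phi x).
Hypothesis phi_cont : {within bb e, continuous phi}.
Hypothesis phi_sm : forall x, bb e x ->
  subsequence (phi x) x /\
  exists (Z : normedModType R) (z : nat -> Z), eps_generates eps (phi x) z.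

Local Notation seg := (spanned_between e).

(* [N a b] is the norm of [a z_1 + b z_2] for the spreading model [z] of [y]. *)
Definition pair_model (y : nat -> X) (N : R -> R -> R) :=
  [/\ forall t a b, N (t * a) (t * b) = `|t| * N a b,
      forall a b a' b', N (a + a') (b + b') <= N a b + N a' b' &
      forall k m n a b, (0 < k)%N -> (k < m)%N -> (m < n)%N ->
        within_factor (1 + eps k) `|a *: y m + b *: y n| (N a b)].

Lemma phi_pair_model x : bb e x -> exists N, pair_model (phi x) N.
Proof.
move=> /phi_sm[_ [Z [z [_ zE]]]]; exists (fun a b => `|a *: z 0%N + b *: z 1%N|).
split=> [t a b|a b a' b'|k m n a b k0 km mn].
- by rewrite -!scalerA -scalerDr normrZ.
- apply: le_trans (ler_normD _ _); rewrite !scalerDl le_eqVlt; apply/orP; left.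
  by apply/eqP; congr (`| _ |); rewrite addrACA.
- case: k k0 km => // k _ km.
  (* The constant for index [k] comes from the estimate on [k.+1] vectors: [m] and [n] are completed
     by later indices, which get coefficient 0. *)
  pose l (i : 'I_k.+2) := if i == 0%N :> nat then m else (n + i.-1)%N.
  have l_homo : {homo l : i j / (i < j)%N}.
    move=> [i ik] [j jk]; rewrite /l /= => ij.
    case: j jk ij => // j jk ij /=; case: i ik ij => //= [_ _|i _ ij].
      by rewrite (leq_trans mn) // leq_addr.
    by rewrite ltn_add2l.
  pose c (i : 'I_k.+2) := if i == 0%N :> nat then a else if i == 1%N :> nat then b else 0.
  have sumE (V : lmodType R) (f : 'I_k.+2 -> V) :
      \sum_(i < k.+2) c i *: f i = a *: f ord0 + b *: f (lift ord0 ord0).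
    rewrite big_ord_recl big_ord_recl /= big1 ?addr0 // => i _.
    by rewrite /c /= scale0r.
  have := zE k.+1 l l_homo km c; rewrite !sumE /l /= /bump /= !addn0 => /andP[h1 h2].
  have C0 : 0 < 1 + eps k.+1 by rewrite addr_gt0.
  by split; first rewrite -ler_pdivrMl.
Qed.

Lemma eps_small C : 1 < C -> exists2 k, (0 < k)%N & 1 + eps k <= C.
Proof.
move=> C1; have /(cvgr0_norm_lt _ eps_cvg0)[K _ KP] : 0 < C - 1 by lra.
exists K.+1 => //; have := KP K.+1 (leqnSn K); rewrite /= ltr_norml; lra.
Qed.

Lemma bb_norm1 x : bb e x -> forall i, `|x i| = 1.
Proof. by case=> c []. Qed.

Lemma pair_model_ge0 y N : pair_model y N -> forall a b, 0 <= N a b.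
Proof.
case=> _ _ /(_ 1 2 3 _ _ isT isT isT) h a b; have [+ _] := h a b.
move=> /(le_trans (normr_ge0 _)); rewrite pmulr_rge0 // addr_gt0 //.
Qed.

(** Since [eps] is given in advance, one [k] serves every sequence and every model; it can be fixed
    before the sequences are built. *)
Lemma pair_model_factor C : 1 < C ->
  exists k, forall y N, pair_model y N -> forall m n a b,
    (k <= m)%N -> (m < n)%N -> within_factor C `|a *: y m + b *: y n| (N a b).
Proof.
move=> /eps_small[k k0 kC]; exists k.+1 => y N yN m n a b km mn.
have [_ _ wf] := yN; apply: within_factor_le kC (wf k m n a b k0 km mn) => //.
exact: pair_model_ge0 yN a b.
Qed.

(** Continuity lets [x] be replaced after its first [L] terms without changing the first [k] terms
    of [phi x]; [M] is the cut after these [L] terms. *)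
Lemma phi_splice x k : bb e x -> exists M, forall p' w,
  block_sequence e p' w -> (M <= p' 0)%N ->
  exists x', [/\ bb e x', forall j, (j < k)%N -> phi x' j = phi x j &
    exists L s, {homo s : i j / (i < j)%N} /\
      forall j, phi x' (L + j)%N = w (s j)].
Proof.
move=> xbb; have [p px] := bb_block_sequence xbb.
have [L LP] := discrete_continuity_modulus k phi_cont xbb.
exists (p L) => p' w p'w pp'.
have x'bb := block_sequence_splice px p'w pp'.
set x' := (fun i : nat => _) in x'bb.
have [[s s_homo phiE] _] := phi_sm x'bb.
have s_ge j : (j <= s j)%N.
  by elim: j => // j ih; apply: leq_ltn_trans ih _; exact: s_homo.
exists x'; split=> //; first by apply: LP => // j jL; rewrite /x' jL.
(* As [s j >= j], the terms of [phi x'] from index [L] on are taken from positions of [x'] at or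
   after [L], which hold [w]. *)
exists L, (fun j => s (L + j)%N - L)%N; split=> [i j ij|j].
  rewrite ltn_sub2r //; last by apply: s_homo; rewrite ltn_add2l.
  by apply: leq_trans (s_ge _); rewrite (leq_ltn_trans (leq_addr i L)) // ltn_add2l.
have Ls : (L <= s (L + j))%N by apply: leq_trans (s_ge _); rewrite leq_addr.
by rewrite phiE /= /x' ltnNge Ls.
Qed.

(* Both models are attained by [phi x'], where [x'] starts as [x] and continues
   as [phi w]. *)
Lemma pair_model_unique x w N N' : bb e x -> bb e w ->
  pair_model (phi x) N -> pair_model (phi w) N' -> N = N'.
Proof.
move=> xbb wbb xN wN'; apply/funext => a; apply/funext => b.
apply: (@within_all_factors_eq _ 3); [exact: pair_model_ge0 xN _ _|exact: pair_model_ge0 wN' _ _|].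
move=> C C1; have C0 : 0 <= C by lra.
have [k kP] := pair_model_factor C1.
have [M MP] := phi_splice k.+2 xbb.
have [p' p'w] := bb_block_sequence (phi_bb wbb).
(* Dropping [M] terms of [phi w] puts the rest beyond [M], since [M <= p' M]. *)
have [|x' [x'bb x'E [L [s [s_homo x'w]]]]] := MP _ _ (block_sequence_tail M p'w).
  by rewrite addn0 (block_sequence_ge p'w).
have [N'' x'N''] := phi_pair_model x'bb.
(* [phi x] and [phi x'] share their terms of index [k] and [k.+1]. *)
have N_N'' : within_factor (C * C) (N a b) (N'' a b).
  apply: (within_factor_trans C0 C0 (within_factor_sym (kP _ _ xN k k.+1 _ _ _ _))) => //.
  by rewrite -!x'E //; apply: kP.
(* From index [L] on, [phi x'] runs through terms of [phi w]. *)
suff N''_N' : within_factor (C * C) (N'' a b) (N' a b).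
  rewrite (_ : C ^+ 4 = (C * C) * (C * C)); last by rewrite -!expr2 -exprM.
  by apply: within_factor_trans N_N'' N''_N'; rewrite mulr_ge0.
have Lk : (k <= L + k)%N by rewrite leq_addl.
have ks : (k <= M + s k)%N.
  apply: leq_trans (leq_addl _ _); elim: (k) => // j ih.
  by apply: leq_ltn_trans ih _; exact: s_homo.
apply: (within_factor_trans C0 C0 (within_factor_sym (kP _ _ x'N'' _ (L + k.+1)%N _ _ Lk _))).
  by rewrite ltn_add2l.
by rewrite !x'w; apply: kP => //; rewrite ltn_add2l; exact: s_homo.
Qed.

Definition good (N : R -> R -> R) C v M := forall n z, seg M n z -> `|z| = 1 ->
  forall a b, within_factor C `|a *: v + b *: z| (N a b).

(* A block sequence of vectors that are not good, chopped after [phi] has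
   picked one of them and continued by witnesses of the failure, would
   contradict the choice made by [phi]. *)
Lemma far_good w N C : bb e w -> pair_model (phi w) N -> 1 < C ->
  exists M0, forall n v, seg M0 n v -> `|v| = 1 -> exists M, good N C v M.
Proof.
move=> wbb wN C1; apply: contrapT => /forallNP bad.
have norm_lt M n v : seg M n v -> `|v| = 1 -> (M <= n)%N.
  by move=> Mv v1; rewrite ltnW // (spanned_between_lt _ Mv) // -normr_gt0 v1.
have [k kP] := pair_model_factor C1.
pose bad_unit v := `|v| = 1 /\ forall M, ~ good N C v M.
have [|p [x [_ px]]] := @block_recursion _ _ e (fun _ _ => bad_unit) 0%N.
  move=> _ M.
  have /existsNP[n /existsNP[v /not_implyP[Mv /not_implyP[v1 /forallNP vbad]]]] := bad M.
  by exists n, v; split=> //; exact: norm_lt Mv v1.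
have xbb : bb e x.
  by apply: (@block_sequence_bb _ _ _ p) => i; have [? ? []] := px i.
have [M MP] := phi_splice k.+1 xbb.
have vbad M' : ~ good N C (phi x k) M'.
  have [[s _ ->] _] := phi_sm xbb; have [_ _ [_]] := px (s k); exact.
pose witness z := `|z| = 1 /\
  exists a b, ~ within_factor C `|a *: phi x k + b *: z| (N a b).
have [|p' [z [p'0 p'z]]] := @block_recursion _ _ e (fun _ _ => witness) M.
  move=> _ M'.
  have /existsNP[n /existsNP[z /not_implyP[Mz /not_implyP[z1]]]] := vbad M'.
  move=> /existsNP[a /existsNP[b zbad]].
  by exists n, z; split=> //; [exact: norm_lt Mz z1|split=> //; exists a, b].
have [i||x' [x'bb x'E [L [s [s_homo x'z]]]]] := MP p' z.
- by have [? ? []] := p'z i.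
- by rewrite p'0.
have [N' x'N'] := phi_pair_model x'bb.
have NE := pair_model_unique wbb x'bb wN x'N'.
(* The term of [phi x'] of index [L + k.+1] is a witness against its term of index [k], which is
   still [phi x k]; yet [N] is the model of [phi x'] too. *)
have [_ _ [_ [a [b []]]]] := p'z (s k.+1).
rewrite -x'z -x'E // NE; apply: kP => //.
by rewrite addnS ltnS leq_addl.
Qed.

Lemma unit_vector M : exists n v, [/\ (M <= n)%N, seg M n v & `|v| = 1].
Proof.
have [_ basis] := he.
(* Otherwise the coefficient at [M] would be arbitrary and 0 would have two expansions. *)
have eM0 : e M != 0.
  apply/eqP => eM0; have [a [_ a_unique]] := basis 0 I.
  have zero_cvg (c : nat -> R) : (forall i, c i *: e i = 0) ->
      series (fun i => c i *: e i) @ \oo --> (0 : X).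
    move=> c0; rewrite (_ : series _ = fun=> 0); first exact: cvg_cst.
    by apply/funext => n; rewrite /series /= big1.
  have := a_unique (fun=> 0) (zero_cvg _ (fun i => scale0r _)).
  have : a = fun i => (i == M)%:R.
    apply: a_unique; apply: zero_cvg => i; have [->|_] := eqVneq i M.
      by rewrite eM0 scaler0.
    by rewrite scale0r.
  by move=> -> /(congr1 (@^~ M)) /eqP; rewrite eqxx oner_eq0.
exists M.+1, (`|e M|^-1 *: e M); split=> //.
  apply: spanned_betweenZ; exists (fun j => (j == M)%:R) => [j|].
    by have [->|_] := eqVneq j M; rewrite ?leqnn ?ltnSn // eqxx.
  rewrite big_ord_recr /= eqxx scale1r big1 ?add0r // => i _.
  by rewrite ltn_eqF // scale0r.
by rewrite normrZ normfV normr_id mulVf // normr_eq0.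
Qed.

Lemma bb_nonempty : exists x, bb e x.
Proof.
have [p [x [_ px]]] := block_recursion (Q := fun _ _ v => `|v| = 1) 0%N
  (fun _ => unit_vector).
by exists x; exact: block_sequence_bb px.
Qed.

(** * The common two-dimensional spreading model *)

Section Model.
Variables (w : discrete_seq X) (N : R -> R -> R).
Hypothesis wbb : bb e w.
Hypothesis wN : pair_model (phi w) N.

Lemma model_ge0 a b : 0 <= N a b.
Proof. exact: pair_model_ge0 wN a b. Qed.

Lemma modelZ t a b : N (t * a) (t * b) = `|t| * N a b.
Proof. by have [] := wN. Qed.

Lemma modelD a b a' b' : N (a + a') (b + b') <= N a b + N a' b'.
Proof. by have [] := wN. Qed.

Lemma model_a0 a : N a 0 = `|a|.
Proof.
apply/esym/(@within_all_factors_eq _ 0); rewrite ?model_ge0 // => C C1.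
have [k kP] := pair_model_factor C1.
have := kP _ _ wN k k.+1 a 0 (leqnn k) (ltnSn k).
by rewrite scale0r addr0 normrZ bb_norm1 ?mulr1 ?expr1 //; exact: phi_bb.
Qed.

Lemma model_0b b : N 0 b = `|b|.
Proof.
apply/esym/(@within_all_factors_eq _ 0); rewrite ?model_ge0 // => C C1.
have [k kP] := pair_model_factor C1.
have := kP _ _ wN k k.+1 0 b (leqnn k) (ltnSn k).
by rewrite scale0r add0r normrZ bb_norm1 ?mulr1 ?expr1 //; exact: phi_bb.
Qed.

Lemma good_far C v M M' n z a b : good N C v M -> (M <= M')%N ->
  seg M' n z -> `|z| = 1 -> within_factor C `|a *: v + b *: z| (N a b).
Proof.
move=> vM MM' Mz z1.
exact: (vM n z (spanned_between_widen MM' (leqnn n) Mz) z1 a b).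
Qed.

(** By normalizing [z], a whole tail of a sum can play the second vector of the pair. *)
Lemma good_tail C v M n z a : 1 <= C -> `|v| = 1 -> good N C v M ->
  seg M n z -> within_factor C `|a *: v + z| (N a `|z|).
Proof.
move=> C1 v1 vM Mz; have [->|z0] := eqVneq z 0.
  rewrite addr0 normr0 model_a0 normrZ v1 mulr1; exact: within_factor_refl.
have nz0 : `|z| != 0 by rewrite normr_eq0.
rewrite -{1}[z]scale1r -(mulfV nz0) -scalerA; apply: (vM n).
  exact: spanned_betweenZ.
by rewrite normrZ normfV normr_id mulVf.
Qed.

(** A far vector [v] and its opposite are both good, and [a *: v] is also [- a *: - v]; a common
    partner [z] compares the two values. *)
Lemma model_Na a b : N (- a) b = N a b.
Proof.
apply: (@within_all_factors_eq _ 1); rewrite ?model_ge0 // => C C1.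
have C0 : 0 <= C by lra.
have [M0 M0P] := far_good wbb wN C1.
have [n [v [_ Mv v1]]] := unit_vector M0.
have [M vM] := M0P _ _ Mv v1.
have Mv' : seg M0 n (- v) by rewrite -scaleN1r; exact: spanned_betweenZ.
have [M' v'M'] : exists M, good N C (- v) M by apply: M0P Mv' _; rewrite normrN.
have [n' [z [_ Mz z1]]] := unit_vector (maxn M M').
rewrite expr2; apply: (within_factor_trans C0 C0 (within_factor_sym _) _); last first.
  exact: (good_far _ _ vM (leq_maxl _ _) Mz z1).
rewrite -[a *: v]opprK -scalerN -scaleNr.
exact: (good_far _ _ v'M' (leq_maxr _ _) Mz z1).
Qed.

Lemma model_aN a b : N a (- b) = N a b.
Proof.
rewrite -[in LHS](opprK a) -(mulN1r (- a)) -(mulN1r b) modelZ normrN1 mul1r.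
exact: model_Na.
Qed.

Lemma model_abs a b : N `|a| `|b| = N a b.
Proof.
have [a0|a0] := leP 0 a; have [b0|b0] := leP 0 b;
by rewrite ?(ger0_norm a0) ?(ltr0_norm a0) ?(ger0_norm b0) ?(ltr0_norm b0)
  ?model_Na ?model_aN.
Qed.

(** Writing [a] as a convex combination of [a'] and [- a'] derives monotonicity from the triangle
    inequality and sign invariance. *)
Let mono_weight (a a' : R) : 0 <= a <= a' -> exists t : R,
  [/\ 0 <= t, t <= 1 & a = t * a' + (1 - t) * - a'].
Proof.
move=> /andP[a0 aa']; have [a'0|a'0] := eqVneq a' 0.
  by exists 0; rewrite a'0; split; lra.
have a'_gt0 : 0 < a' by rewrite lt_neqAle eq_sym a'0 (le_trans a0).
exists ((a / a' + 1) / 2).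
have q0 : 0 <= a / a' by rewrite divr_ge0 // ltW.
have q1 : a / a' <= 1 by rewrite ler_pdivrMr // mul1r.
have aE : a = a / a' * a' by rewrite divfK.
split; [lra|lra|]; rewrite {1}aE; move: (a / a') => q; lra.
Qed.

Let model_mono_l a a' b : 0 <= a <= a' -> N a b <= N a' b.
Proof.
move=> /mono_weight[t [t0 t1 ->]].
rewrite {1}(_ : b = t * b + (1 - t) * b); last by lra.
apply: le_trans (modelD _ _ _ _) _.
by rewrite !modelZ model_Na -mulrDl !ger0_norm ?subr_ge0 // addrC subrK mul1r.
Qed.

Let model_mono_r a b b' : 0 <= b <= b' -> N a b <= N a b'.
Proof.
move=> /mono_weight[t [t0 t1 ->]].
rewrite {1}(_ : a = t * a + (1 - t) * a); last by lra.
apply: le_trans (modelD _ _ _ _) _.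
by rewrite !modelZ model_aN -mulrDl !ger0_norm ?subr_ge0 // addrC subrK mul1r.
Qed.

Lemma model_mono a b a' b' :
  0 <= a <= a' -> 0 <= b <= b' -> N a b <= N a' b'.
Proof. by move=> aa' /(model_mono_r a') /(le_trans (model_mono_l b aa')). Qed.

(** Since [C >= 1], enlarging the other argument to [C * a] as well lets homogeneity pull [C]
    out. *)
Lemma model_within_r C a s t : 1 <= C -> 0 <= s -> 0 <= t ->
  within_factor C s t -> within_factor C (N a s) (N a t).
Proof.
move=> C1 s0 t0 [st ts].
have half s' t' : 0 <= s' -> s' <= C * t' -> N a s' <= C * N a t'.
  move=> s'0 st'; rewrite -[X in X * _]ger0_norm; last by lra.
  rewrite -modelZ -model_abs -(model_abs (C * a)); apply: model_mono.
    by rewrite normr_ge0 normrM ler_peMl // ger0_norm //; lra.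
  by rewrite normr_ge0 /= ger0_norm // (le_trans st') // ler_norm.
by split; exact: half.
Qed.

Lemma model_within_l C s t b : 1 <= C -> 0 <= s -> 0 <= t ->
  within_factor C s t -> within_factor C (N s b) (N t b).
Proof.
move=> C1 s0 t0 [st ts].
have half s' t' : 0 <= s' -> s' <= C * t' -> N s' b <= C * N t' b.
  move=> s'0 st'; rewrite -[X in X * _]ger0_norm; last by lra.
  rewrite -modelZ -model_abs -(model_abs _ (C * b)); apply: model_mono.
    by rewrite normr_ge0 /= ger0_norm // (le_trans st') // ler_norm.
  by rewrite normr_ge0 normrM ler_peMl // ger0_norm //; lra.
by split; exact: half.
Qed.

(** Both sides approximate the norm of [a *: u + b *: v + c *: z] for successive far vectors: either
    the first two are grouped, their normalized sum being good again, or the last two, as a tail.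
    Each grouping costs [C] twice. *)
Lemma model_assoc a b c : 0 < a -> 0 < b -> 0 < c ->
  N (N a b) c = N a (N b c).
Proof.
move=> a0 b0 c0; apply: (@within_all_factors_eq _ 3); rewrite ?model_ge0 // => C C1.
have C0 : 0 <= C by lra.
have C1' := ltW C1.
have [M0 M0P] := far_good wbb wN C1.
have [n1 [u [_ Mu u1]]] := unit_vector M0.
have [M1 uM1] := M0P _ _ Mu u1.
(* Beyond [M0], so that [v] is good; beyond [M1], so that it is a partner for [u]. *)
have [n2 [v [_ Mv v1]]] := unit_vector (maxn M0 M1).
have [M2 vM2] : exists M, good N C v M.
  by apply: M0P v1; exact: (spanned_between_widen (leq_maxl _ _) (leqnn _) Mv).
pose s := a *: u + b *: v.
have s_ab : within_factor C `|s| (N a b).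
  exact: (good_far _ _ uM1 (leq_maxr _ _) Mv v1).
have ab0 : 0 < N a b.
  apply: (lt_le_trans a0); rewrite -{1}(ger0_norm (ltW a0)) -model_a0.
  by apply: model_mono; rewrite ?lexx ltW.
have s_gt0 : 0 < `|s|.
  have [_ /(lt_le_trans ab0)] := s_ab; rewrite pmulr_rgt0 //; lra.
have Ms : seg M0 (maxn n1 n2) s.
  apply: spanned_betweenD; apply: spanned_betweenZ.
    exact: spanned_between_widen (leqnn _) (leq_maxl _ _) Mu.
  exact: spanned_between_widen (leq_maxl _ _) (leq_maxr _ _) Mv.
have s'1 : `| `|s|^-1 *: s| = 1.
  by rewrite normrZ normfV normr_id mulVf // gt_eqF.
have [M3 sM3] := M0P _ _ (spanned_betweenZ _ Ms) s'1.
have [n4 [z [_ Mz z1]]] := unit_vector (maxn (maxn M1 M2) M3).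
have sz : s + c *: z = `|s| *: (`|s|^-1 *: s) + c *: z.
  by rewrite scalerA mulfV ?gt_eqF // scale1r.
have h1 : within_factor C `|s + c *: z| (N `|s| c).
  by rewrite {1}sz; apply: (good_far _ _ sM3 (leq_maxr _ _) Mz z1).
have h2 := model_within_l c C1' (normr_ge0 _) (ltW ab0) s_ab.
have h3 : within_factor C `|b *: v + c *: z| (N b c).
  apply: (good_far _ _ vM2 _ Mz z1).
  by rewrite (leq_trans (leq_maxr M1 M2)) // leq_maxl.
have h4 : within_factor C `|s + c *: z| (N a `|b *: v + c *: z|).
  rewrite /s -addrA; apply: (@good_tail _ _ M1 (maxn n2 n4)) => //.
  apply: spanned_betweenD; apply: spanned_betweenZ.
    exact: spanned_between_widen (leq_maxr _ _) (leq_maxl _ _) Mv.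
  apply: spanned_between_widen (leq_maxr _ _) Mz.
  by rewrite (leq_trans (leq_maxl M1 M2)) // leq_maxl.
have h5 := model_within_r a C1' (normr_ge0 _) (model_ge0 _ _) h3.
rewrite (_ : C ^+ 4 = (C * C) * (C * C)); last by rewrite -!expr2 -exprM.
apply: (@within_factor_trans _ _ _ _ `|s + c *: z|); rewrite ?mulr_ge0 //.
  apply: within_factor_sym; exact: (within_factor_trans C0 C0 h1 h2).
exact: (within_factor_trans C0 C0 h4 h5).
Qed.

Lemma model_max_or_lp :
  (forall a b, N a b = Num.max `|a| `|b|) \/
  exists2 p : R, 1 <= p & forall a b, N a b `^ p = `|a| `^ p + `|b| `^ p.
Proof.
have N_homo (t a b : R) : 0 <= t -> N (t * a) (t * b) = t * N a b.
  by move=> t0; rewrite modelZ ger0_norm.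
have N10 : N 1 0 = 1 by rewrite model_a0 normr1.
have N01 : N 0 1 = 1 by rewrite model_0b normr1.
have N11 : N 1 1 <= 2.
  have := modelD 1 0 0 1; rewrite N10 N01 addr0 add0r; lra.
have [Nmax|[p p1 Np]] := bohnenblust N_homo N10 N01 N11 model_mono model_assoc.
  by left=> a b; rewrite -model_abs Nmax.
by right; exists p => // a b; rewrite -model_abs Np.
Qed.

(** Nested to the right, to match peeling off the first vector and keeping the rest as one tail. *)
Fixpoint iterated_model (a : nat -> R) (m l : nat) : R :=
  if l is l'.+1 then N (a m) (iterated_model a m.+1 l') else 0.

(* The distortion [K] is reached through the increasing constants
   [D i = K - (K - 1) / 2 ^ i]: the vector [v i] accounts for [D i.+1 / D i]. *)
Lemma almost_isometric_sequence K : 1 < K -> exists v : nat -> X,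
  (forall i, `|v i| = 1) /\ forall a m l,
    within_factor K `|\sum_(m <= i < m + l) a i *: v i| (iterated_model a m l).
Proof.
move=> K1; pose D i : R := K - (K - 1) / 2 ^+ i.
have pow0 i : 0 < 2 ^+ i :> R by rewrite exprn_gt0.
have D_ltS i : D i < D i.+1.
  rewrite ltrD2l ltrN2 ltr_pM2l ?subr_gt0 // ltf_pV2 ?posrE // exprS.
  by rewrite ltr_pMl // ltr1n.
have D_ltK i : D i < K by rewrite ltrBlDr ltrDl divr_gt0 // subr_gt0.
have D_ge1 i : 1 <= D i.
  elim: i => [|i ih]; first by rewrite /D expr0 divr1; lra.
  exact: le_trans ih (ltW (D_ltS i)).
have D_gt0 i : 0 < D i by apply: lt_le_trans (D_ge1 i).
have D_homo : {homo D : i j / (i <= j)%N >-> i <= j}.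
  by apply: homo_leq => [//|i j k|i]; [exact: le_trans|exact/ltW/D_ltS].
pose kappa i := D i.+1 / D i.
have kappa_gt1 i : 1 < kappa i by rewrite ltr_pdivlMr // mul1r.
pose Q i n v := `|v| = 1 /\ good N (kappa i) v n.
have [|p [v [_ pv]]] := @block_recursion _ _ e Q 0%N.
  move=> i M; have [M0 M0P] := far_good wbb wN (kappa_gt1 i).
  have [n [v [Mn Mv v1]]] := unit_vector (maxn M0 M).
  have [L vL] := M0P _ _ (spanned_between_widen (leq_maxl _ _) (leqnn _) Mv) v1.
  (* The cut passes both the support of [v] and the threshold [L], so all later vectors are partners
     for [v]. *)
  exists (maxn n L), v; split.
  - by rewrite (leq_trans _ (leq_maxl n L)) // (leq_trans _ Mn) // leq_maxr.
  - exact: spanned_between_widen (leq_maxr _ _) (leq_maxl _ _) Mv.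
  - split=> // n' z Mz z1 a b; exact: (good_far _ _ vL (leq_maxr _ _) Mz z1).
exists v; split=> [i|a m l]; first by have [_ _ []] := pv i.
have p_homo : {homo p : i j / (i <= j)%N}.
  by apply: homo_leq => [//|i j k|i]; [exact: leq_trans|have [] := pv i].
have sum_seg i k : seg (p i) (p (i + k)%N) (\sum_(i <= j < i + k) a j *: v j).
  elim: k => [|k ih]; first by rewrite addn0 big_geq //; exact: spanned_between0.
  rewrite addnS big_nat_recr ?leq_addr //=; apply: spanned_betweenD.
    exact: spanned_between_widen (leqnn _) (p_homo _ _ (leqnSn _)) ih.
  apply: spanned_betweenZ; have [_ + _] := pv (i + k)%N.
  by apply: spanned_between_widen => //; apply: p_homo; rewrite leq_addr.
have iter_ge0 i k : 0 <= iterated_model a i k.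
  by case: k => [|k] //=; exact: model_ge0.
have tail_within i k : within_factor (D (i + k)%N / D i)
    `|\sum_(i <= j < i + k) a j *: v j| (iterated_model a i k).
  elim: k i => [|k ih] i.
    by rewrite addn0 big_geq // normr0 /=; split; rewrite mulr0.
  rewrite big_ltn ?addnS ?ltnS ?leq_addr // -addSn; set z := \sum_(_ <= _ < _) _.
  have c1 : 1 <= D (i.+1 + k)%N / D i.+1.
    by rewrite ler_pdivlMr // mul1r D_homo // leq_addr.
  have [_ _ [vi1 vi_good]] := pv i.
  have h1 := good_tail (a i) (ltW (kappa_gt1 i)) vi1 vi_good (sum_seg i.+1 k).
  have h2 := model_within_r (a i) c1 (normr_ge0 _) (iter_ge0 _ _) (ih i.+1).
  (* Peeling off [v i] costs [kappa i], the remaining tail [D (i.+1 + k) / D i.+1]; the product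
     telescopes. *)
  rewrite (_ : _ / _ = kappa i * (D (i.+1 + k)%N / D i.+1)).
    apply: (within_factor_trans _ _ h1 h2); last exact: le_trans ler01 c1.
    exact/ltW/(lt_trans ltr01 (kappa_gt1 i)).
  by rewrite /kappa [RHS]mulrC mulrA mulfVK // gt_eqF.
apply: within_factor_le (tail_within m l) => //.
by rewrite ler_pdivrMr // (le_trans (ltW (D_ltK _))) // ler_peMr //; lra.
Qed.


End Model.
End ContinuousChoice.

(** * Isomorphisms onto the closed span of a basic sequence *)

Section Embedding.
Context {R : realType} {X : completeNormedModType R}.

Lemma cvg_series_tailsP (V : completeNormedModType R) (u : nat -> V) :
  cvgn (series u) <-> forall d, 0 < d -> exists M, forall m n,
    (M <= m)%N -> (m <= n)%N -> `|\sum_(m <= i < n) u i| <= d.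
Proof.
split=> [/cvg_cauchy/cauchy_seriesP uc d d0|tails].
  have [[A B] /= [[M1 _ M1A] [M2 _ M2B]] AB] := uc d d0.
  exists (maxn M1 M2) => m n; rewrite geq_max => /andP[Mm1 Mm2] mn.
  apply/ltW/(AB (m, n)); split; first exact: M1A.
  exact/M2B/(leq_trans Mm2).
apply/cauchy_cvgP/cauchy_seriesP => d d0.
have [|M MP] := tails (d / 2); first by lra.
exists ([set n | (M <= n)%N], [set n | (M <= n)%N]).
  by split; exists M.
move=> [m n] /= [Mm Mn]; have [mn|nm] := leqP m n.
  by apply: le_lt_trans (MP _ _ Mm mn) _; lra.
by rewrite big_geq ?normr0 // ltnW.
Qed.

Variables (v : nat -> X) (C : R).
Hypothesis v1 : forall i, `|v i| = 1.
Hypothesis C_ge0 : 0 <= C.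
Hypothesis v_basis : forall (a : nat -> R) m n, (m <= n)%N ->
  `|\sum_(0 <= i < m) a i *: v i| <= C * `|\sum_(0 <= i < n) a i *: v i|.

Local Notation expansion a := (series (fun i => a i *: v i)).

Definition basis_closed_span : set X :=
  [set x | exists a : nat -> R, expansion a @ \oo --> x].

Lemma expansion_lin s a b x y : expansion a @ \oo --> x ->
  expansion b @ \oo --> y ->
  expansion (fun i => s * a i + b i) @ \oo --> s *: x + y.
Proof.
move=> ax bx; rewrite (_ : series _ = fun n => s *: expansion a n + expansion b n).
  by apply: cvgD bx; apply: cvgZ ax; exact: cvg_cst.
apply/funext => n; rewrite /series /= scaler_sumr -big_split /=.
by apply: eq_bigr => i _; rewrite scalerDl scalerA.
Qed.

Lemma expansion_le a x m : expansion a @ \oo --> x ->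
  `|expansion a m| <= C * `|x|.
Proof.
move=> ax; have Cax : C * `|expansion a n| @[n --> \oo] --> C * `|x|.
  by apply: cvgM; [exact: cvg_cst|exact: cvg_norm].
apply: ler_cvg_to (cvg_cst `|expansion a m|) Cax _.
by exists m => // n mn; exact: v_basis.
Qed.

Lemma expansion_coef_le a x i : expansion a @ \oo --> x ->
  `|a i| <= 2 * C * `|x|.
Proof.
move=> ax; have -> : `|a i| = `|expansion a i.+1 - expansion a i|.
  by rewrite seriesSB normrZ v1 mulr1.
apply: le_trans (ler_normB _ _) _.
by rewrite -mulrA mulr_natl mulr2n lerD // expansion_le.
Qed.

(** Coefficients depend boundedly on the vector, so those of approximants [y n] converge; the bound
    on partial sums is uniform in their length, which makes the limit coefficients expand [x]. *)
Lemma basis_closed_span_closed : closed basis_closed_span.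
Proof.
move=> x xcl.
have /choice[ya yaP] (n : nat) : exists ya : X * (nat -> R),
    expansion ya.2 @ \oo --> ya.1 /\ `|x - ya.1| < n.+1%:R^-1.
  have [|y [[a ay] xy]] := xcl (ball x n.+1%:R^-1).
    by apply: nbhsx_ballx; rewrite invr_gt0.
  by exists (y, a); split=> //; move: xy; rewrite -ball_normE.
pose y n := (ya n).1; pose b n := (ya n).2.
have by_ n : expansion (b n) @ \oo --> y n by have [] := yaP n.
have y_x : y @ \oo --> x.
  apply/cvgrPdist_le => d d0.
  have /cvgr0_norm_le /(_ _ d0) := @cvg_harmonic R.
  apply: filterS => n /= nd; have [_ /ltW/le_trans] := yaP n; apply.
  by apply: le_trans nd; rewrite ler_norm.
have diff_cvg n k : expansion (fun i => b n i - b k i) @ \oo --> y n - y k.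
  rewrite (_ : series _ = expansion (fun i => -1 * b k i + b n i)).
    by rewrite [y n - _]addrC -(scaleN1r (y k)); exact: expansion_lin.
  by congr series; apply/funext => i; rewrite mulN1r addrC.
have y_cauchy d : 0 < d -> exists M, forall n k, (M <= n)%N -> (M <= k)%N ->
    `|y n - y k| <= d.
  move=> d0; have [|M _ MP] := (cvgr_dist_le _ _ y_x) (d / 2); first by lra.
  exists M => n k /MP /= xn /MP /= xk.
  rewrite (_ : y n - y k = (x - y k) - (x - y n)).
    apply: le_trans (ler_normB _ _) _; lra.
  by rewrite opprB [RHS]addrC addrA subrK.
have b_cvg i : cvgn (fun n => b n i).
  apply/cauchy_cvgP/cauchy_exP => d d0.
  have C1 : 0 < 2 * C + 1 by rewrite ltr_wpDl ?mulr_ge0.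
  have [|M MP] := y_cauchy (d / (2 * (2 * C + 1))); first by rewrite divr_gt0 ?mulr_gt0.
  exists (b M i), M => // n /= Mn; rewrite -ball_normE /=.
  apply: le_lt_trans (expansion_coef_le i (diff_cvg M n)) _.
  have := MP M n (leqnn M) Mn; rewrite ler_pdivlMr ?mulr_gt0 //.
  have := normr_ge0 (y M - y n); nra.
pose a i := limn (fun n => b n i).
have exp_cvg m : expansion (b k) m @[k --> \oo] --> expansion a m.
  elim: m => [|m ih].
    rewrite /series /= big_geq //; apply: cvg_near_cst; apply: nearW => k.
    by rewrite big_geq.
  rewrite seriesSr; under eq_fun do rewrite seriesSr.
  by apply: (cvgD ih); apply: cvgZ; [exact: b_cvg|exact: cvg_cst].
(* The partial-sum bound for [y n - y k], in the limit over [k]. *)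
have a_bound n m : `|expansion (b n) m - expansion a m| <= C * `|y n - x|.
  have l_cvg : `|expansion (b n) m - expansion (b k) m| @[k --> \oo] -->
      `|expansion (b n) m - expansion a m|.
    by apply: cvg_norm; apply: cvgB; [exact: cvg_cst|exact: exp_cvg].
  have r_cvg : C * `|y n - y k| @[k --> \oo] --> C * `|y n - x|.
    apply: cvgM; first exact: cvg_cst.
    by apply: cvg_norm; apply: cvgB; [exact: cvg_cst|exact: y_x].
  apply: ler_cvg_to l_cvg r_cvg _; apply: nearW => k.
  apply: le_trans (expansion_le m (diff_cvg n k)).
  rewrite /series /= -sumrB le_eqVlt; apply/orP; left; apply/eqP; congr (`| _ |).
  by apply: eq_bigr => i _; rewrite scalerBl.
exists a; apply/cvgrPdist_le => d d0.
have C1 : 0 < C + 1 by rewrite ltr_wpDl.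
have [|n _ nP] := (cvgr_dist_le _ _ y_x) (d / (2 * (C + 1))).
  by rewrite divr_gt0 ?mulr_gt0.
have {nP} := nP n (leqnn n); rewrite /= ler_pdivlMr; last by lra.
move=> xn.
have [|M _ MP] := (cvgr_dist_le _ _ (by_ n)) (d / 2); first by lra.
exists M => // m /MP /= nm.
rewrite (_ : x - _ = (x - y n) +
    ((y n - expansion (b n) m) + (expansion (b n) m - expansion a m))).
  apply: le_trans (ler_normD _ _) _.
  have := le_trans (ler_normD _ _) (lerD nm (a_bound n m)).
  rewrite (distrC (y n)); lra.
by rewrite !subrKA.
Qed.

(** The isomorphism sums the expansion. It is injective because the coefficient bound makes every
    expansion of 0 trivial; it and its inverse are bounded by [K] each, whence [K * K]. *)
Lemma contains_isomorph_of_basis (E : set (nat -> R)) (Nrm : (nat -> R) -> R)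
    (K : R) : 0 <= K ->
  (forall a, E a <-> cvgn (expansion a)) ->
  (forall a, E a -> exists2 u : nat -> R, u @ \oo --> Nrm a &
     forall n, within_factor K `|expansion a n| (u n)) ->
  contains_isomorph X E Nrm (K * K).
Proof.
move=> K0 EP NrmP.
pose T a := limn (expansion a).
have TP a : E a -> expansion a @ \oo --> T a by move=> /EP.
exists basis_closed_span, T, K, K; split=> //.
- split; first exact: basis_closed_span_closed.
    exists (fun=> 0); rewrite (_ : series _ = fun=> 0); first exact: cvg_cst.
    by apply/funext => n; rewrite /series /= big1 // => i _; rewrite scale0r.
  move=> s x y [a ax] [b bY]; exists (fun i => s * a i + b i).
  exact: expansion_lin.
- split.
  + by move=> a /TP aT; exists a.
  + move=> a b /set_mem/TP aT /set_mem/TP bT Tab; apply/funext => i.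
    have := @expansion_lin (-1) _ _ _ _ aT bT; rewrite Tab scaleN1r addNr.
    move=> /(expansion_coef_le i); rewrite normr0 mulr0 normr_le0.
    by rewrite mulN1r addrC subr_eq0 => /eqP.
  + move=> x [a ax]; exists a; first by apply/EP/cvg_ex; exists x.
    exact: cvg_lim ax.
- move=> s a b /TP aT /TP bT; apply: cvg_lim => //; exact: expansion_lin.
- move=> a Ea; have [u uN uP] := NrmP a Ea.
  have nT : `|expansion a n| @[n --> \oo] --> `|T a|.
    exact: cvg_norm (TP a Ea).
  split.
  + have Ku : K * u n @[n --> \oo] --> K * Nrm a.
      by apply: cvgM uN; exact: cvg_cst.
    by apply: (ler_cvg_to nT Ku); apply: nearW => n; have [] := uP n.
  + have Kn : K * `|expansion a n| @[n --> \oo] --> K * `|T a|.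
      by apply: cvgM nT; exact: cvg_cst.
    by apply: (ler_cvg_to uN Kn); apply: nearW => n; have [] := uP n.
Qed.

End Embedding.

(** * Recognition of c_0 and l_p *)

Section SequenceSpaces.
Context {R : realType} {X : completeNormedModType R}.
Variables (v : nat -> X) (K : R).
Hypothesis K_ge1 : 1 <= K.
Hypothesis v1 : forall i, `|v i| = 1.

(** Here [part a m n] stands for the norm of [a] cut to the indices from [m] to [n - 1]. Its
    monotonicity gives the basis constant [K * K], and its smallness on tails is the Cauchy
    condition in [X]. *)
Lemma contains_isomorph_of_truncations (E : set (nat -> R))
    (Nrm : (nat -> R) -> R) (part : (nat -> R) -> nat -> nat -> R) :
  (forall a m n, (m <= n)%N ->
     within_factor K `|\sum_(m <= i < n) a i *: v i| (part a m n)) ->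
  (forall a m n, (m <= n)%N -> part a 0%N m <= part a 0%N n) ->
  (forall a, E a <-> forall d, 0 < d -> exists M, forall m n,
     (M <= m)%N -> (m <= n)%N -> part a m n <= d) ->
  (forall a, E a -> part a 0%N n @[n --> \oo] --> Nrm a) ->
  contains_isomorph X E Nrm (K * K).
Proof.
move=> part_within part_mono EP part_cvg.
have K0 : 0 <= K by exact: le_trans ler01 K_ge1.
have Kgt0 : 0 < K by exact: lt_le_trans ltr01 K_ge1.
apply: (@contains_isomorph_of_basis _ _ v (K * K)) => //.
- exact: mulr_ge0.
- move=> a m n mn; have [h1 _] := part_within a _ _ (leq0n m).
  have [_ h2] := part_within a _ _ (leq0n n).
  apply: le_trans h1 _; rewrite -mulrA ler_wpM2l //.
  exact: le_trans (part_mono a _ _ mn) h2.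
- move=> a; rewrite EP cvg_series_tailsP; split=> tails d d0.
    have [|M MP] := tails (d / K); first by rewrite divr_gt0.
    exists M => m n Mm mn; have [h _] := part_within a _ _ mn.
    by apply: le_trans h _; rewrite mulrC -ler_pdivlMr // MP.
  have [|M MP] := tails (d / K); first by rewrite divr_gt0.
  exists M => m n Mm mn; have [_ h] := part_within a _ _ mn.
  by apply: le_trans h _; rewrite mulrC -ler_pdivlMr // MP.
- move=> a Ea; exists (part a 0%N); first exact: part_cvg.
  by move=> n; exact: part_within.
Qed.

Section C0.
Hypothesis v_max : forall a m l,
  within_factor K `|\sum_(m <= i < m + l) a i *: v i|
    (iterated_model (fun b c : R => Num.max `|b| `|c|) a m l).

Local Notation part := (iterated_model (fun b c : R => Num.max `|b| `|c|)).

Let part_ge0 a m l : 0 <= part a m l.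
Proof. by case: l => //= l; rewrite le_max normr_ge0. Qed.

Let part_le a m l d : 0 <= d ->
  (forall i, (m <= i < m + l)%N -> `|a i| <= d) -> part a m l <= d.
Proof.
move=> d0; elim: l m => //= l ih m ad; rewrite ge_max ad ?leqnn ?addnS ?ltnS ?leq_addr //.
rewrite ger0_norm // ih // => i /andP[mi il]; apply: ad.
by rewrite (ltnW mi) addnS -addSn.
Qed.

Let part_ge a m l i : (m <= i < m + l)%N -> `|a i| <= part a m l.
Proof.
elim: l m => [|l ih] m; first by rewrite addn0 ltnNge andbN.
rewrite leq_eqVlt => /andP[/predU1P[->|mi] il] /=; rewrite le_max ?lexx //.
apply/orP; right; rewrite (ger0_norm (part_ge0 _ _ _)); apply: ih.
by rewrite mi addSn -addnS.
Qed.

(** A maximum over a tail is small exactly when its entries are, so the Cauchy condition is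
    convergence to 0; partial maxima increase to the supremum. *)
Lemma contains_isomorph_c0 : contains_isomorph X (@c0_space R) (@c0_norm R) (K * K).
Proof.
apply: (@contains_isomorph_of_truncations _ _ (fun a m n => part a m (n - m)%N)).
- by move=> a m n mn; rewrite -{1}(subnKC mn); exact: v_max.
- move=> a m n mn; rewrite !subn0; apply: part_le => // i /andP[_ im].
  by apply: part_ge; rewrite (leq_trans im).
- move=> a; split=> [/cvgr0_norm_le a0 d d0|tails].
    have [M _ MP] := a0 d d0; exists M => m n Mm mn.
    apply: part_le (ltW d0) _ => i /andP[mi _]; exact/MP/(leq_trans Mm).
  apply/cvgr0Pnorm_le => d d0; have [M MP] := tails d d0.
  exists M => // i Mi; apply: le_trans (MP i i.+1 Mi (leqnSn i)).
  by apply: part_ge; rewrite leqnn subSnn addn1 ltnSn.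
- move=> a a0; rewrite /c0_norm; set S := range (fun i => `|a i|).
  have a_bounded : has_ubound S.
    have [M _ MP] := cvgr0_norm_le _ a0 _ (@ltr01 R).
    exists (Num.max 1 (part a 0%N M)) => _ [i _ <-]; rewrite le_max.
    have [Mi|iM] := leqP M i; first by rewrite MP.
    by rewrite part_ge ?orbT.
  have S0 : S !=set0 by exists `|a 0%N|, 0%N.
  apply/cvgrPdist_le => d d0.
  have [_ [i _ <-] ai] := sup_adherent d0 (conj S0 a_bounded).
  exists i.+1 => // n /= ni; rewrite subn0.
  have := @part_ge a 0%N n i ni.
  have sup_ge : part a 0%N n <= sup S.
    apply: part_le => [|j _]; last by apply: ub_le_sup => //; exists j.
    by apply: le_trans (normr_ge0 (a 0%N)) _; apply: ub_le_sup => //; exists 0%N.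
  move=> aip; rewrite ger0_norm ?subr_ge0 //.
  by rewrite lerBlDr addrC -lerBlDr (le_trans (ltW ai)).
Qed.

End C0.

Section Lp.
Variables (p : R) (N : R -> R -> R).
Hypothesis p_ge1 : 1 <= p.
Hypothesis N_ge0 : forall a b, 0 <= N a b.
Hypothesis N_pow : forall a b, N a b `^ p = `|a| `^ p + `|b| `^ p.
Hypothesis v_lp : forall a m l,
  within_factor K `|\sum_(m <= i < m + l) a i *: v i| (iterated_model N a m l).

Let p_gt0 : 0 < p. Proof. exact: lt_le_trans ltr01 p_ge1. Qed.
Let pV_gt0 : 0 < p^-1. Proof. by rewrite invr_gt0. Qed.

Let powK (x : R) : 0 <= x -> (x `^ p) `^ p^-1 = x.
Proof. by move=> x0; rewrite -powRrM mulfV ?gt_eqF // powRr1. Qed.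

Let powVK (x : R) : 0 <= x -> (x `^ p^-1) `^ p = x.
Proof. by move=> x0; rewrite -powRrM mulVf ?gt_eqF // powRr1. Qed.

Let pow_le (r x y : R) : 0 < r -> 0 <= x -> x <= y -> x `^ r <= y `^ r.
Proof.
by move=> r0 x0 xy; apply: ge0_ler_powR; rewrite ?nnegrE ?(ltW r0) // (le_trans x0).
Qed.

Let pow_sum (a : nat -> R) m n := \sum_(m <= i < n) `|a i| `^ p.

Let pow_sum_ge0 a m n : 0 <= pow_sum a m n.
Proof. by apply: sumr_ge0 => i _; exact: powR_ge0. Qed.

(** Raising to the power [p] turns each nested [N] into a sum. *)
Let iteratedE a m l : iterated_model N a m l = pow_sum a m (m + l)%N `^ p^-1.
Proof.
have it_ge0 k l' : 0 <= iterated_model N a k l' by case: l' => /=.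
rewrite -[LHS]powK //; congr (_ `^ _).
elim: l m => [|l ih] m /=; first by rewrite /pow_sum addn0 big_geq // powR0 // gt_eqF.
by rewrite N_pow (ger0_norm (it_ge0 _ _)) ih /pow_sum [RHS]big_ltn ?addSnnS // addnS ltnS leq_addr.
Qed.

Let nneseriesE (a : nat -> R) : (\sum_(0 <= k <oo) `|(EFin \o a) k| `^ p)%E =
  limn (EFin \o series (fun i => `|a i| `^ p)).
Proof.
congr (limn _); apply/funext => n; rewrite /= /series /= -sumEFin.
by apply: eq_bigr => k _; rewrite -poweR_EFin.
Qed.

Let lp_normE a : cvgn (series (fun i => `|a i| `^ p)) ->
  'N[counting]_(p%:E)[EFin \o a]%E =
    (limn (series (fun i => `|a i| `^ p)) `^ p^-1)%:E.
Proof. by move=> ?; rewrite Lnorm_counting // nneseriesE EFin_lim // poweR_EFin. Qed.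

Let lp_spaceP a :
  lp_space p a <-> cvgn (series (fun i => `|a i| `^ p)).
Proof.
split=> [|?]; last by rewrite /lp_space /= lp_normE // ltry.
rewrite /lp_space /= Lnorm_counting // => /lty_poweRy; rewrite gt_eqF // => /(_ isT).
move=> sum_fin; apply: nondecreasing_is_cvgn.
  move=> m n mn; rewrite /series /= (big_cat_nat _ mn) //= lerDl.
  exact: pow_sum_ge0.
exists (fine (\sum_(0 <= k <oo) `|(EFin \o a) k| `^ p)%E) => _ [n _ <-].
have term_ge0 k : (0 <= `|(EFin \o a) k| `^ p)%E by exact: poweR_ge0.
rewrite -lee_fin fineK; last first.
  by rewrite ge0_fin_numE //; exact: nneseries_ge0.
apply: le_trans (nneseries_lim_ge n (fun k _ _ => term_ge0 k)).
rewrite /series /= -sumEFin le_eqVlt; apply/orP; left; apply/eqP.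
by apply: eq_bigr => k _; rewrite -poweR_EFin.
Qed.

Let pow_sum_mono a m n : (m <= n)%N -> pow_sum a 0%N m <= pow_sum a 0%N n.
Proof.
move=> mn; rewrite /pow_sum (big_cat_nat _ mn) //= lerDl.
exact: pow_sum_ge0.
Qed.

Lemma contains_isomorph_lp : contains_isomorph X (lp_space p) (lp_norm p) (K * K).
Proof.
apply: (@contains_isomorph_of_truncations _ _ (fun a m n => pow_sum a m n `^ p^-1)).
- move=> a m n mn; have := v_lp a m (n - m)%N.
  by rewrite iteratedE subnKC.
- by move=> a m n mn; apply: pow_le => //; exact: pow_sum_mono.
- move=> a; rewrite lp_spaceP (@cvg_series_tailsP _ R^o).
  split=> tails d d0.
    have [|M MP] := tails (d `^ p); first exact: powR_gt0.
    exists M => m n Mm mn; rewrite -(powK (ltW d0)); apply: pow_le => //.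
    by apply: le_trans (MP m n Mm mn); exact: ler_norm.
  have [|M MP] := tails (d `^ p^-1); first exact: powR_gt0.
  exists M => m n Mm mn; rewrite ger0_norm; last exact: pow_sum_ge0.
  rewrite -(powVK (ltW d0)) -[X in X <= _](powVK (pow_sum_ge0 _ _ _)).
  by apply: pow_le; rewrite ?powR_ge0 //; exact: MP.
- move=> a Ea; have s_cvg : cvgn (series (fun i => `|a i| `^ p)) by exact/lp_spaceP.
  rewrite /lp_norm lp_normE //=; set L := limn _.
  have s_mono : nondecreasing_seq (series (fun i => `|a i| `^ p)).
    by move=> m n mn; exact: pow_sum_mono.
  have s_le n : pow_sum a 0%N n <= L by exact: nondecreasing_cvgn_le.
  have L0 : 0 <= L by exact: le_trans (pow_sum_ge0 a 0%N 0%N) (s_le 0%N).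
  have u_mono : nondecreasing_seq (fun n => pow_sum a 0%N n `^ p^-1).
    by move=> m n mn; apply: pow_le => //; exact: pow_sum_mono.
  have u_cvg : cvgn (fun n => pow_sum a 0%N n `^ p^-1).
    apply: nondecreasing_is_cvgn => //; exists (L `^ p^-1) => _ [n _ <-].
    exact: pow_le.
  (* The root passes through the limit by order alone: one inequality is checked after raising to
     the power [p], the other holds since every truncation is at most [L]. *)
  rewrite (_ : L `^ p^-1 = limn (fun n => pow_sum a 0%N n `^ p^-1)) //.
  have u_le := nondecreasing_cvgn_le u_mono u_cvg.
  set L' := limn _ in u_le *; apply/eqP; rewrite eq_le; apply/andP; split.
    have L'0 : 0 <= L' by exact: le_trans (powR_ge0 _ _) (u_le 0%N).
    rewrite -(powK L'0); apply: pow_le => //; apply: limr_le => //.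
    apply: nearW => n; rewrite -[X in X <= _](powVK (pow_sum_ge0 a 0%N n)).
    by apply: pow_le; rewrite ?powR_ge0.
  apply: limr_le => //; apply: nearW => n; exact: pow_le.
Qed.

End Lp.
End SequenceSpaces.

(** * From the form of the model to copies in [X] *)

Theorem proposition10 (R : realType) (X : completeNormedModType R)
    (e : nat -> X) (he : schauder_basis e)
    (eps : nat -> R) (eps_gt0 : forall i, 0 < eps i)
    (eps_noninc : nonincreasing_seq eps) (eps_cvg0 : eps @ \oo --> (0 : R))
    (phi : discrete_seq X -> discrete_seq X)
    (phi_bb : forall x, bb e x -> bb e (phi x))
    (phi_cont : {within bb e, continuous phi})
    (phi_sm : forall x, bb e x ->
       subsequence (phi x) x /\
       exists (Z : normedModType R) (z : nat -> Z), eps_generates eps (phi x) z) :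
  contains_almost_isometric_copies X (@c0_space R) (@c0_norm R) \/
  exists p : R, 1 <= p /\
    contains_almost_isometric_copies X (lp_space p) (lp_norm p).
Proof.
have [w wbb] := bb_nonempty he.
have [N wN] := phi_pair_model eps_gt0 phi_sm wbb.
(* [N] comes from one [w] and does not depend on [K], so the same alternative and the same [p] serve
   every [delta]. *)
have copies K : 1 < K -> exists v : nat -> X,
    (forall i, `|v i| = 1) /\ forall a m l,
    within_factor K `|\sum_(m <= i < m + l) a i *: v i| (iterated_model N a m l).
  exact: (almost_isometric_sequence he eps_gt0 eps_cvg0 phi_bb phi_cont phi_sm wbb wN).
have [N_max|[p p1 N_lp]] :=
  model_max_or_lp he eps_gt0 eps_cvg0 phi_bb phi_cont phi_sm wbb wN.
(* [K] is the square root of [1 + delta], since the distortion obtained is [K * K]. *)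
- left=> delta d0; have [|K K1 KE] := @exp_root_gt1 _ 1 (1 + delta).
    by rewrite ltrDl.
  have [v [v1 vP]] := copies K K1; rewrite -KE expr2.
  have NE : N = fun b c => Num.max `|b| `|c|.
    by apply/funext => b; apply/funext => c; exact: N_max.
  by rewrite NE in vP; apply: contains_isomorph_c0 (ltW K1) v1 vP.
- right; exists p; split=> // delta d0.
  have [|K K1 KE] := @exp_root_gt1 _ 1 (1 + delta); first by rewrite ltrDl.
  have [v [v1 vP]] := copies K K1; rewrite -KE expr2.
  exact: (contains_isomorph_lp (ltW K1) v1 p1 (pair_model_ge0 eps_gt0 wN) N_lp vP).
Qed.
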